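(* Let $d\in\mathbb N$ and let $X_1,\dots,X_d$ be real-valued random variables on an atomless probability space (no integrability assumed). If a counter-monotonic version $(X_1^{\rm ct},\dots,X_d^{\rm ct})$ of $(X_1,\dots,X_d)$ exists, then $$X_1^{\rm ct}+\cdots+X_d^{\rm ct}\le_{\rm cx} X_1+\cdots+X_d.$$
   Context: An expectation $\mathbb E[V]$ is well-defined if $\mathbb E[\max\{V,0\}]<\infty$ or $\mathbb E[\max\{-V,0\}]<\infty$. We write $U\le_{\rm cx}V$ if $\mathbb E[u(U)]\le\mathbb E[u(V)]$ for all convex $u:\mathbb R\to\mathbb R$ such that both expectations are well-defined. A pair $(X,Y)$ is comonotonic if $X=f(Z)$, $Y=g(Z)$ a.s. for some random variable $Z$ and increasing $f,g$, and counter-monotonic if $(X,-Y)$ is comonotonic. A random vector is counter-monotonic if each pair of its components is counter-monotonic. A counter-monotonic version of $(X_1,\dots,X_d)$ is a counter-monotonic random vector $(X_1',\dots,X_d')$ with $X_i'$ distributed as $X_i$ for each $i$. *)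

(* Defs.v *)
From HB Require Import structures.
From mathcomp Require Import all_boot all_order all_algebra.
From mathcomp Require Import all_classical all_reals all_analysis.
Set Implicit Arguments. Unset Strict Implicit. Unset Printing Implicit Defensive.
Import Order.TTheory GRing.Theory Num.Theory.
Local Open Scope classical_set_scope.
Local Open Scope ring_scope.

Section defs.
Context {d : measure_display} {T : measurableType d} {R : realType}.
Variable P : probability T R.

Definition atomless : Prop :=
  forall A : set T, measurable A -> (0 < P A)%E ->
    exists B : set T, [/\ measurable B, B `<=` A & (0 < P B < P A)%E].

Definition exp_well_defined (V : T -> R) : Prop :=
  ('E_P[fun w => Num.max (V w) 0%R] < +oo)%E \/
  ('E_P[fun w => Num.max (- V w)%R 0%R] < +oo)%E.

Definition convex_fun (u : R -> R) : Prop :=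
  forall (x y t : R), 0 <= t <= 1 ->
    u (t * x + (1 - t) * y) <= t * u x + (1 - t) * u y.

Definition cx_le (U V : T -> R) : Prop :=
  forall u : R -> R, convex_fun u ->
    exp_well_defined (u \o U) -> exp_well_defined (u \o V) ->
    ('E_P[u \o U] <= 'E_P[u \o V])%E.

Definition comonotonic (X Y : T -> R) : Prop :=
  exists (Z : {RV P >-> R}) (f g : R -> R),
    (forall x y, x <= y -> f x <= f y) /\
    (forall x y, x <= y -> g x <= g y) /\
    {ae P, forall w, X w = f (Z w) /\ Y w = g (Z w)}.

Definition counter_monotonic (X Y : T -> R) : Prop :=
  comonotonic X (fun w => - Y w).

Definition counter_monotonic_vec (n : nat) (X : 'I_n -> T -> R) : Prop :=
  forall i j : 'I_n, i != j -> counter_monotonic (X i) (X j).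

Definition same_distribution (X Y : T -> R) : Prop :=
  forall A : set R, measurable A -> P (X @^-1` A) = P (Y @^-1` A).

Definition counter_monotonic_version (n : nat) (X Xc : 'I_n -> {RV P >-> R}) : Prop :=
  counter_monotonic_vec (fun i => (Xc i : T -> R)) /\
  forall i, same_distribution (X i) (Xc i).

End defs.

(* Main.v *)
(** Truncating a convex [u] from below by [-M] and letting [M] grow (monotone
    convergence) reduces the claim to convex [w >= 0], where no integrability is
    needed.  Off a null set the components of a counter-monotonic vector are
    pairwise antitone functions on the sample space.  Combinatorially this forces
    one of three shapes: all but two components are constant, or all components
    lie above (respectively below) some [M] with at most one of them off [M] at a
    time.  In the last two cases superadditivity of the increments of [w] gives
    [sum_k w (a + y_k) + w a <= w (a + sum_k y_k) + n w a] for [y_k] of constant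
    sign, with equality when at most one [y_k] is nonzero, and the left-hand side
    only depends on the marginals.  For two variables, after clamping and
    rounding to a grid, [E w (X + Y)] is a marginal term plus a nonnegative
    combination of the probabilities [P (X > a, Y > b)], each of which is
    smallest for a counter-monotonic pair; the clamps are then removed using
    Fatou's lemma on one side and dominated convergence on the other. *)
Require Import Defs.
From HB Require Import structures.
From mathcomp Require Import all_boot all_order all_algebra.
From mathcomp Require Import all_classical all_reals all_analysis.
From mathcomp Require Import measurable_realfun lra ring.
Import Order.TTheory GRing.Theory Num.Theory.
Import numFieldNormedType.Exports.
Local Open Scope classical_set_scope.
Local Open Scope ring_scope.
Set Implicit Arguments. Unset Strict Implicit. Unset Printing Implicit Defensive.

(** * Convex functions on the line: increments, continuity and second differences *)

Section convex.
Context {R : realType}.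
Implicit Types w u : R -> R.

(** Chord inequality with denominators cleared, so that the degenerate case [a = c] is covered. *)
Lemma convex_fun_slope w (a b c : R) : convex_fun w -> a <= b -> b <= c ->
  (c - a) * w b <= (c - b) * w a + (b - a) * w c.
Proof.
move=> cw ab bc; have [ac|ac] := eqVneq a c.
  have -> : b = a by apply/eqP; rewrite eq_le ab {1}ac bc.
  by rewrite -ac; lra.
have ac0 : 0 < c - a by rewrite subr_gt0 lt_neqAle ac (le_trans ab bc).
have t01 : 0 <= (c - b) / (c - a) <= 1.
  by rewrite divr_ge0 ?ler_pdivrMr ?mul1r ?(ltW ac0)//=; lra.
have := cw a c _ t01.
have -> : (c - b) / (c - a) * a + (1 - (c - b) / (c - a)) * c = b.
  by field; rewrite gt_eqF.
rewrite -(ler_pM2l ac0) => /le_trans; apply.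
rewrite le_eqVlt; apply/orP; left; apply/eqP; field.
by rewrite gt_eqF.
Qed.

(** The points [a + s] and [a + t] lie between [a] and [a + s + t] and have the same sum as these
    end points; adding their two chord inequalities gives the claim. *)
Lemma convex_fun_superadd w (a s t : R) : convex_fun w -> 0 <= s * t ->
  w (a + s) + w (a + t) <= w (a + s + t) + w a.
Proof.
move=> cw st.
have pos x y z : 0 <= y -> 0 <= z -> w (x + y) + w (x + z) <= w (x + y + z) + w x.
  move=> y0 z0; have [yz|yz] := eqVneq (y + z) 0.
    have -> : y = 0 by lra.
    have -> : z = 0 by lra.
    by rewrite !addr0.
  have yz0 : 0 < y + z by rewrite lt_neqAle eq_sym yz addr_ge0.
  have := @convex_fun_slope w x (x + y) (x + y + z) cw ltac:(lra) ltac:(lra).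
  have := @convex_fun_slope w x (x + z) (x + y + z) cw ltac:(lra) ltac:(lra).
  have -> : x + y + z - x = y + z by ring.
  have -> : x + y + z - (x + y) = z by ring.
  have -> : x + y + z - (x + z) = y by ring.
  have -> : x + y - x = y by ring.
  have -> : x + z - x = z by ring.
  by move=> h1 h2; rewrite -(ler_pM2l yz0); nra.
have [s0|s0] := leP 0 s; have [t0|t0] := leP 0 t; first exact: pos.
- have -> : s = 0 by nra.
  by rewrite !addr0 addrC.
- have -> : t = 0 by nra.
  by rewrite !addr0.
(* With both increments negative, the positive case is read from the lower end point [a + s + t]. *)
- have := pos (a + s + t) (- s) (- t) ltac:(lra) ltac:(lra).
  have -> : a + s + t - s = a + t by ring.
  have -> : a + s + t - t = a + s by ring.
  have -> : a + t - t = a by ring.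
  lra.
Qed.

(** Iterates [convex_fun_superadd]: each partial sum has the sign of the next increment. No term is
    subtracted, so for [w >= 0] both sides can be integrated in the extended reals. *)
Lemma convex_fun_sum_le w (n : nat) (a : R) (y : 'I_n -> R) : convex_fun w ->
  (forall i, 0 <= y i) \/ (forall i, y i <= 0) ->
  \sum_i w (a + y i) + w a <= w (a + \sum_i y i) + n%:R * w a.
Proof.
move=> cw; elim: n y => [|n IH] y y0.
  by rewrite !big_ord0 mul0r !addr0 add0r.
rewrite !big_ord_recr/=.
have := IH (fun i => y (widen_ord (leqnSn n) i)).
have -> : ((forall i, 0 <= y (widen_ord (leqnSn n) i)) \/
           (forall i, y (widen_ord (leqnSn n) i) <= 0)) = True.
  by apply/propext; split => // _; case: y0 => y0; [left|right] => i.
move=> /(_ I).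
set S := \sum_i y _; set W := \sum_i w _ => h.
have st : 0 <= S * y ord_max.
  by case: y0 => y0; [apply: mulr_ge0|apply: mulr_le0] => //;
    [apply: sumr_ge0|apply: sumr_le0].
have := convex_fun_superadd a cw st.
rewrite -natr1 mulrDl mul1r.
by rewrite [a + (S + _)]addrA; lra.
Qed.

(** The equality case of [convex_fun_sum_le]: at most one increment survives, and every other
    summand is [w a]. *)
Lemma sum_disjoint_support w (n : nat) (a : R) (y : 'I_n -> R) :
  (forall i j, i != j -> y i = 0 \/ y j = 0) ->
  \sum_i w (a + y i) + w a = w (a + \sum_i y i) + n%:R * w a.
Proof.
move=> y0; have [[i yi]|none] := pselect (exists i, y i != 0).
  have y0' j : j != i -> y j = 0.
    by move=> ji; have [//|/eqP] := y0 _ _ ji; rewrite (negbTE yi).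
  rewrite (bigD1 i)//= [\sum_j y j](bigD1 i)//= [\sum_(j < n | _) y j]big1//.
  under eq_bigr => j ji do rewrite (y0' _ ji) addr0.
  rewrite sumr_const (_ : #|_| = n.-1); last by rewrite -[n in RHS]card_ord -(cardC1 i).
  by rewrite addr0 -addrA -mulrSr prednK ?mulr_natl// (leq_ltn_trans _ (ltn_ord i)).
have y0' i : y i = 0.
  by apply/eqP/negPn/negP => yi; apply: none; exists i.
under eq_bigr do rewrite y0' addr0.
by rewrite [\sum_i y i]big1// sumr_const card_ord addr0 mulr_natl addrC.
Qed.

Lemma convex_fun_max w u : convex_fun w -> convex_fun u ->
  convex_fun (fun x => Num.max (w x) (u x)).
Proof.
move=> cw cu x y t t01; have /andP[t0 t1] := t01; rewrite ge_max; apply/andP; split.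
  apply: le_trans (cw _ _ _ t01) _; apply: lerD; apply: ler_wpM2l;
    rewrite ?le_max ?lexx//; lra.
apply: le_trans (cu _ _ _ t01) _; apply: lerD; apply: ler_wpM2l;
    rewrite ?le_max ?lexx ?orbT//; lra.
Qed.

Lemma convex_fun_shift w (c : R) :
  convex_fun w -> convex_fun (fun x => w (x + c)).
Proof.
move=> cw x y t t01; have := cw (x + c) (y + c) t t01.
by have -> : t * (x + c) + (1 - t) * (y + c) = t * x + (1 - t) * y + c by ring.
Qed.

Lemma convex_fun_addr w (c : R) :
  convex_fun w -> convex_fun (fun x => w x + c).
Proof. by move=> cw x y t t01; have := cw x y t t01; lra. Qed.

Lemma convex_fun_le_max w (a x b : R) : convex_fun w -> a <= x <= b ->
  w x <= Num.max (w a) (w b).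
Proof.
move=> cw /andP[ax xb]; have [ab|ab] := eqVneq a b.
  by rewrite -ab maxxx; have -> : x = a by lra.
have := convex_fun_slope cw ax xb.
have ba : 0 < b - a by rewrite subr_gt0 lt_neqAle ab; lra.
have am : w a <= Num.max (w a) (w b) by rewrite le_max lexx.
have bm : w b <= Num.max (w a) (w b) by rewrite le_max lexx orbT.
move=> h; rewrite -(ler_pM2l ba); apply: le_trans h _.
nra.
Qed.

(** Chords from [a] of length at most 1 have slopes between those of the chords to [a - 1] and
    [a + 1]; the constant dominates both. It is used for continuity, hence measurability. *)
Lemma convex_fun_lipschitz w (a : R) : convex_fun w ->
  exists2 C, 0 <= C & forall t, `|t| <= 1 -> `|w (a + t) - w a| <= C * `|t|.
Proof.
move=> cw; exists (`|w (a + 1) - w a| + `|w (a - 1) - w a|) => [|t].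
  by rewrite addr_ge0.
rewrite ler_norml => /andP[t1 t2].
have A := ler_norm (w (a + 1) - w a).
have B := ler_norm (w (a - 1) - w a).
have A0 := normr_ge0 (w (a + 1) - w a).
have B0 := normr_ge0 (w (a - 1) - w a).
set A' := `|w (a + 1) - w a| in A A0 *; set B' := `|w (a - 1) - w a| in B B0 *.
rewrite ler_norml; have [t0|t0] := ger0P t.
  have := @convex_fun_slope w a (a + t) (a + 1) cw ltac:(lra) ltac:(lra).
  have := @convex_fun_slope w (a - 1) a (a + t) cw ltac:(lra) ltac:(lra).
  by move=> h1 h2; apply/andP; split; nra.
have := @convex_fun_slope w (a - 1) (a + t) a cw ltac:(lra) ltac:(lra).
have := @convex_fun_slope w (a + t) a (a + 1) cw ltac:(lra) ltac:(lra).
by move=> h1 h2; apply/andP; split; nra.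
Qed.

Lemma convex_fun_continuous w : convex_fun w -> continuous w.
Proof.
move=> cw a; have [C C0 hC] := convex_fun_lipschitz a cw.
apply/cvgrPdist_lt => e e0; near=> x.
rewrite distrC -[x](addrNK a) [X in w X]addrC.
apply: le_lt_trans (hC _ _) _.
  rewrite distrC; near: x.
  by exists 1 => //= x /= /ltW.
(* [C + 1] keeps the divisor positive even if [C = 0]. *)
apply: (@le_lt_trans _ _ ((C + 1) * `|x - a|)); first by apply: ler_wpM2r => //; lra.
rewrite mulrC -ltr_pdivlMr; last lra.
rewrite distrC; near: x.
exists (e / (C + 1)) => //=; first by apply: divr_gt0 => //; lra.
Unshelve. all: by end_near. Qed.

Lemma convex_fun_measurable w : convex_fun w -> measurable_fun [set: R] w.
Proof. by move/convex_fun_continuous; exact: continuous_measurable_fun. Qed.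

(** The joint dependence on [i] and [j] is isolated in a double sum of second differences, which are
    nonnegative when [v] samples a convex function on a grid. *)
Lemma sum_telescope2 (v : nat -> R) (i j : nat) :
  v (i + j)%N + v 0 = v i + v j +
  \sum_(a < i) \sum_(b < j) (v (a + b).+2 - v (a + b).+1 *+ 2 + v (a + b)%N).
Proof.
have inner a : \sum_(b < j) (v (a + b).+2 - v (a + b).+1 *+ 2 + v (a + b)%N) =
    v (a.+1 + j)%N - v (a + j)%N - (v a.+1 - v a).
  elim: j => [|j IH]; first by rewrite big_ord0 !addn0; lra.
  rewrite big_ord_recr/= IH !addnS !addSn; lra.
under eq_bigr do rewrite inner.
elim: i => [|i IH]; first by rewrite big_ord0 add0n; lra.
by rewrite big_ord_recr/=; lra.
Qed.

End convex.

(** * Expectations of nonnegative functions and transfer between equal laws *)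

Section ge0_expectation.
Context {d : measure_display} {T : measurableType d} {R : realType}.
Context (P : probability T R).
Implicit Types (X Y : T -> R) (g : R -> R).

Lemma ge0_expectationD X Y :
  measurable_fun [set: T] X -> measurable_fun [set: T] Y ->
  (forall t, 0 <= X t) -> (forall t, 0 <= Y t) ->
  'E_P[(fun t => X t + Y t)%R]%E = ('E_P[X] + 'E_P[Y])%E.
Proof.
move=> mX mY X0 Y0; rewrite unlock -ge0_integralD//.
- by move=> t _; rewrite lee_fin.
- exact/measurable_EFinP.
- by move=> t _; rewrite lee_fin.
- exact/measurable_EFinP.
Qed.

Lemma ge0_expectation_sum (I : finType) (X : I -> T -> R) :
  (forall i, measurable_fun [set: T] (X i)) -> (forall i t, 0 <= X i t) ->
  'E_P[(fun t => \sum_i X i t)%R]%E = (\sum_i 'E_P[X i])%E.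
Proof.
move=> mX X0; rewrite unlock -ge0_integral_sum//.
- by apply: eq_integral => t _; rewrite sumEFin.
- by move=> i; apply/measurable_EFinP.
- by move=> i t _; rewrite lee_fin.
Qed.

Lemma ge0_expectationZl (k : R) X : measurable_fun [set: T] X ->
  (forall t, 0 <= X t) -> 0 <= k ->
  'E_P[(fun t => k * X t)%R]%E = (k%:E * 'E_P[X])%E.
Proof.
move=> mX X0 k0; rewrite unlock -ge0_integralZl//.
- exact/measurable_EFinP.
- by move=> t _; rewrite lee_fin.
Qed.

Lemma ge0_ae_eq_expectation X Y :
  measurable_fun [set: T] X -> measurable_fun [set: T] Y ->
  (forall t, 0 <= X t) -> (forall t, 0 <= Y t) ->
  {ae P, forall t, X t = Y t} -> 'E_P[X]%E = 'E_P[Y]%E.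
Proof.
move=> mX mY X0 Y0 XY; apply/eqP; rewrite eq_le !expectation_le//.
- by apply: filterS XY => t ->.
- by apply: filterS XY => t ->.
Qed.

Lemma same_distribution_expectation (X Y : {RV P >-> R}) g :
  same_distribution P X Y -> measurable_fun [set: R] g ->
  (forall x, 0 <= g x) -> 'E_P[g \o X]%E = 'E_P[g \o Y]%E.
Proof.
move=> XY mg g0; rewrite unlock.
have mg' : measurable_fun [set: R] (EFin \o g) by exact/measurable_EFinP.
have := @ge0_integral_distribution _ _ T R R P X _ mg' (fun y => g0 y).
have := @ge0_integral_distribution _ _ T R R P Y _ mg' (fun y => g0 y).
rewrite /comp => <- <-; apply: eq_measure_integral => A mA _.
exact: XY.
Qed.

Lemma same_distribution_ae (X Y : {RV P >-> R}) (A : set R) :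
  same_distribution P X Y -> measurable A ->
  {ae P, forall t, A (Y t)} -> {ae P, forall t, A (X t)}.
Proof.
move=> XY mA AY.
have mAC : measurable (~` A) by exact: measurableC.
have mp (Z : {RV P >-> R}) : measurable (Z @^-1` (~` A)).
  by rewrite -[X in measurable X]setTI; exact: measurable_funP.
apply/negligibleP; first exact: mp.
rewrite -[LHS]/(P (X @^-1` (~` A))) XY//.
exact/negligibleP.
Qed.

End ge0_expectation.

(** * Recovering an inequality of expectations from truncations below *)

Lemma le_expectation_of_truncations (d : measure_display) (T : measurableType d)
    (R : realType) (P : probability T R) (U V : T -> R) :
  measurable_fun [set: T] U -> measurable_fun [set: T] V ->
  exp_well_defined P V ->
  (forall M : nat, 'E_P[(fun t => Num.max (U t + M%:R) 0)%R] <=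
                   'E_P[(fun t => Num.max (V t + M%:R) 0)%R])%E ->
  ('E_P[U] <= 'E_P[V])%E.
Proof.
move=> mU mV wV UV.
pose p (W : T -> R) t : R := Num.max (W t) 0.
pose m (W : T -> R) t : R := Num.max (- W t) 0.
pose mM (W : T -> R) (M : nat) t : R := Num.min (m W t) M%:R.
have EW (W : T -> R) : 'E_P[W]%E = ('E_P[p W] - 'E_P[m W])%E.
  rewrite unlock integralE; congr (_ - _)%E; apply: eq_integral => t _.
    by rewrite funeposE EFin_max.
  by rewrite funenegE EFin_max EFinN.
have mp (W : T -> R) : measurable_fun [set: T] W -> measurable_fun [set: T] (p W).
  by move=> mW; apply: measurable_maxr.
have mm (W : T -> R) : measurable_fun [set: T] W -> measurable_fun [set: T] (m W).
  by move=> mW; apply: measurable_maxr => //; exact: measurableT_comp.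
have mmM (W : T -> R) M : measurable_fun [set: T] W -> measurable_fun [set: T] (mM W M).
  by move=> mW; apply: measurable_minr => //; exact: mm.
have p0 (W : T -> R) t : 0 <= p W t by rewrite le_max lexx orbT.
have m0 (W : T -> R) t : 0 <= m W t by rewrite le_max lexx orbT.
have mM0 (W : T -> R) M t : 0 <= mM W M t by rewrite le_min m0/=.
(* Truncating [W] at [-M] replaces the negative part [m W] by [mM W M]; adding [M] and moving terms
   across avoids subtraction. *)
have split (W : T -> R) M : measurable_fun [set: T] W ->
    ('E_P[(fun t => Num.max (W t + M%:R) 0)%R] + 'E_P[mM W M] = 'E_P[p W] + M%:R%:E)%E.
  move=> mW; rewrite -(expectation_cst P M%:R) -!ge0_expectationD//.
  - congr expectation; apply/funext => t; rewrite /mM /m /p/=.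
    have := ler0n R M; rewrite /Num.max /Num.min; do ?[case: ifPn]; rewrite -?leNgt; lra.
  - exact: mp.
  - apply: measurable_maxr => //; exact: measurable_funD.
  - exact: mmM.
  - by move=> t; rewrite le_max lexx orbT.
have cvgm (W : T -> R) : measurable_fun [set: T] W ->
    'E_P[mM W M]%E @[M --> \oo] --> 'E_P[m W]%E.
  move=> mW; rewrite unlock.
  have -> : (\int[P]_w (m W w)%:E = \int[P]_w limn (fun M => (mM W M w)%:E))%E.
    apply: eq_integral => t _; apply/esym/cvg_lim => //.
    apply: cvg_near_cst; near=> M; rewrite /mM min_l//.
    near: M; exact: nbhs_infty_ger.
  apply: cvg_monotone_convergence => //.
  - by move=> M; apply/measurable_EFinP; exact: mmM.
  - by move=> M t _; rewrite lee_fin.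
  - move=> t _ a b ab; rewrite lee_fin /mM le_min !ge_min lexx/= ler_nat ab orbT//.
have EV0 : (0 <= 'E_P[p V])%E by apply: expectation_ge0.
have EmU0 : (0 <= 'E_P[m U])%E by apply: expectation_ge0.
have EmV0 : (0 <= 'E_P[m V])%E by apply: expectation_ge0.
have EU0 : (0 <= 'E_P[p U])%E by apply: expectation_ge0.
(* If the positive part of [V] has infinite mean, well-definedness forces
   ['E_P[V] = +oo]. *)
have [EVoo|] := eqVneq 'E_P[p V]%E +oo%E.
  case: wV => [|h]; first by rewrite -[X in (X < _)%E]/('E_P[p V]%E) EVoo.
  have {}h : ('E_P[m V] < +oo)%E by [].
  rewrite [leRHS]EW EVoo addye ?leey//.
  by case: ('E_P[m V])%E h EmV0.
rewrite -ltey => EVy.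
(* The case [M = 0] compares the positive parts, so finiteness passes from [V] to [U]. *)
have EUV : ('E_P[p U] <= 'E_P[p V])%E.
  have := UV 0; rewrite (_ : (fun t => Num.max (U t + 0%:R) 0) = p U).
    by rewrite (_ : (fun t => Num.max (V t + 0%:R) 0) = p V)//; apply/funext => t; rewrite /p addr0.
  by apply/funext => t; rewrite /p addr0.
have EUy := le_lt_trans EUV EVy.
have EUf : 'E_P[p U]%E \is a fin_num by rewrite ge0_fin_numE.
have EVf : 'E_P[p V]%E \is a fin_num by rewrite ge0_fin_numE.
have fM (W : T -> R) M : measurable_fun [set: T] W -> 'E_P[mM W M]%E \is a fin_num.
  move=> mW; rewrite ge0_fin_numE ?expectation_ge0//.
  apply: (@le_lt_trans _ _ ('E_P[cst M%:R%R])%E); last by rewrite expectation_cst ltry.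
  apply: expectation_le => //; first exact: mmM.
  by apply: nearW => t; rewrite /mM ge_min lexx orbT.
(* On the right the truncated negative part is already replaced by its upper bound, so only the left
   side depends on [M] in the limit. *)
have key M : ('E_P[p U] + 'E_P[mM V M] <= 'E_P[p V] + 'E_P[m U])%E.
  apply: (@le_trans _ _ ('E_P[p V] + 'E_P[mM U M])%E); last first.
    apply: leeD => //; apply: expectation_le => //; [exact: mmM|exact: mm|].
    by apply: nearW => t; rewrite /mM ge_min lexx.
  have := split U M mU; have := split V M mV; have := UV M.
  have := fM U M mU; have := fM V M mV; move: EUf EVf.
  have : (0 <= 'E_P[(fun t => Num.max (U t + M%:R) 0)%R])%E.
    by apply: expectation_ge0 => t; rewrite le_max lexx orbT.
  have : (0 <= 'E_P[(fun t => Num.max (V t + M%:R) 0)%R])%E.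
    by apply: expectation_ge0 => t; rewrite le_max lexx orbT.
  move: 'E_P[(fun t => Num.max (U t + M%:R) 0)%R]%E => a.
  move: 'E_P[(fun t => Num.max (V t + M%:R) 0)%R]%E => b.
  move: 'E_P[p U]%E 'E_P[p V]%E 'E_P[mM U M]%E 'E_P[mM V M]%E.
  move: a b => [a| |] [b| |] [pu| |] [pv| |] [mu| |] [mv| |] // _ _ _ _ _ _.
  rewrite -!EFinD !lee_fin => h [h1] [h2]; lra.
have key' : ('E_P[p U] + 'E_P[m V] <= 'E_P[p V] + 'E_P[m U])%E.
  have : ('E_P[p U] + 'E_P[mM V M])%E @[M --> \oo] --> ('E_P[p U] + 'E_P[m V])%E.
    apply: cvgeD; [|exact: cvg_cst|exact: cvgm].
    by rewrite fin_num_adde_defr.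
  move=> /cvge_to_le; apply; exact: nearW.
rewrite [leLHS]EW [leRHS]EW.
move: EUf EVf EmU0 EmV0 key'.
case: 'E_P[p U]%E => [pu| |]//; case: 'E_P[p V]%E => [pv| |]//.
case: 'E_P[m U]%E => [mu| |]//; case: 'E_P[m V]%E => [mv| |]// _ _ _ _.
- by rewrite -!EFinD !lee_fin; lra.
- by move=> _; rewrite addeNy leNye.
Unshelve. all: by end_near. Qed.

(** Outside [N] no two sample points are strictly ordered the same way by both variables. The strict
    premise allows ties and makes the relation symmetric in [X] and [Y]. *)
Definition ae_antitone (d : measure_display) (T : measurableType d)
    (R : realType) (P : probability T R) (X Y : T -> R) :=
  exists N, [/\ measurable N, P N = 0%E &
    forall s t, ~ N s -> ~ N t -> X s < X t -> Y t <= Y s].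

Lemma nondecreasing_nat_measurable (R : realType) (f : R -> nat) :
  {homo f : x y / x <= y >-> (x <= y)%N} -> measurable_fun [set: R] f.
Proof.
move=> fh _ /= B _; rewrite setTI.
rewrite (_ : f @^-1` B = \bigcup_(k in B) (f @^-1` [set k])); last first.
  by apply/seteqP; split => [x Bx|x [k Bk fxk]];
    [exists (f x)|by rewrite /preimage/= fxk].
apply: bigcup_measurable => k _; apply: is_interval_measurable => x y /= fx fy z.
move=> /andP[/fh xz /fh zy]; apply/eqP.
by rewrite eqn_leq -[X in (_ <= X)%N]fy zy -[X in (X <= _)%N]fx xz.
Qed.

(** * Two variables rounded to finitely many levels *)

Section two_variables.
Context {d : measure_display} {T : measurableType d} {R : realType}.
Context (P : probability T R).
Implicit Types X Y : {RV P >-> R}.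

(* The lower Frechet bound is attained: [A `&` B] or the complement of
   [A `|` B] is null. *)
Lemma antitone_measureI_le (N A B A' B' : set T) :
  measurable N -> measurable A -> measurable B ->
  measurable A' -> measurable B' ->
  P N = 0%E -> P A = P A' -> P B = P B' ->
  (forall s t, ~ N s -> ~ N t -> A s -> B s -> ~ A t -> B t) ->
  (P (A `&` B) <= P (A' `&` B'))%E.
Proof.
move=> mN mA mB mA' mB' N0 AA BB h.
have [[s [Ns As Bs]]|noAB] := pselect (exists s, [/\ ~ N s, A s & B s]); last first.
  rewrite (_ : P (A `&` B) = 0%E) ?measure_ge0//.
  apply: (@subset_measure0 _ _ _ P _ N) => //; first exact: measurableI.
  move=> t [At Bt]; apply: contrapT => Nt; apply: noAB; by exists t.
(* One point of the intersection outside [N] forces all points outside [N] into the union;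
   inclusion-exclusion then gives [A] and [B] the least possible overlap. *)
have U1 : P (A `|` B) = 1%E.
  apply/eqP; rewrite eq_le probability_le1/=; last exact: measurableU.
  have <- : P (~` N) = 1%E by rewrite probability_setC// N0 sube0.
  apply: le_measure; rewrite ?inE; [exact: measurableC|exact: measurableU|].
  by move=> t Nt; have [At|At] := pselect (A t); [left|right; exact: (h s)].
have E1 : P (A `|` B) = (P A + P B - P (A `&` B))%E.
  by rewrite measureUfinl// -ge0_fin_numE// fin_num_measure.
have E2 : P (A' `|` B') = (P A' + P B' - P (A' `&` B'))%E.
  by rewrite measureUfinl// -ge0_fin_numE// fin_num_measure.
have U2 : (P (A' `|` B') <= 1)%E by apply: probability_le1; exact: measurableU.
move: U2; rewrite E2 -AA -BB -U1 E1.
have : P A \is a fin_num by rewrite fin_num_measure.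
have : P B \is a fin_num by rewrite fin_num_measure.
have : P (A `&` B) \is a fin_num by rewrite fin_num_measure//; exact: measurableI.
have : P (A' `&` B') \is a fin_num by rewrite fin_num_measure//; exact: measurableI.
move: (P A) (P B) (P (A `&` B)) (P (A' `&` B')).
move=> [a| |]// [b| |]// [c| |]// [e| |]// _ _ _ _.
by rewrite -!EFinD !lee_fin; lra.
Qed.

(** Integrates [sum_telescope2] at the levels [f (X t)] and [f (Y t)]. The joint law enters only
    through upper-orthant probabilities, with nonnegative weights. *)
Lemma discrete_expectation_add (v : nat -> R) (f : R -> nat) (m : nat) X Y :
  (forall k, 0 <= v k) ->
  (forall k, 0 <= v k.+2 - v k.+1 *+ 2 + v k) ->
  measurable_fun [set: R] f -> (forall x, f x <= m)%N ->
  ('E_P[(fun t => v (f (X t) + f (Y t))%N)%R] + (v 0)%:E =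
   'E_P[(v \o f) \o X] + 'E_P[(v \o f) \o Y] +
   \sum_(p : 'I_m * 'I_m)
     (v (p.1 + p.2).+2 - v (p.1 + p.2).+1 *+ 2 + v (p.1 + p.2)%N)%:E *
     P ((X @^-1` (f @^-1` [set k | (p.1 < k)%N])) `&`
        (Y @^-1` (f @^-1` [set k | (p.2 < k)%N]))))%E.
Proof.
move=> v0 D0 mf fm.
have mv : measurable_fun [set: nat] v by [].
have mfX (Z : {RV P >-> R}) : measurable_fun [set: T] (f \o Z).
  exact: measurableT_comp.
have mvX (Z : {RV P >-> R}) : measurable_fun [set: T] ((v \o f) \o Z).
  exact: (measurableT_comp mv (mfX Z)).
have mset (Z : {RV P >-> R}) a : measurable (Z @^-1` (f @^-1` [set k | (a < k)%N])).
  by rewrite -[X in measurable X]setTI; exact: (mfX Z).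
pose I (p : 'I_m * 'I_m) := (X @^-1` (f @^-1` [set k | (p.1 < k)%N])) `&`
        (Y @^-1` (f @^-1` [set k | (p.2 < k)%N])).
have mI p : measurable (I p) by exact: measurableI.
pose D (p : 'I_m * 'I_m) := (v (p.1 + p.2).+2 - v (p.1 + p.2).+1 *+ 2 + v (p.1 + p.2)%N).
have D0' p : 0 <= D p by exact: D0.
transitivity ('E_P[(fun t => v (f (X t)) + v (f (Y t)) + \sum_p D p * \1_(I p) t)%R])%E.
  rewrite -(expectation_cst P (v 0)) -ge0_expectationD//; last 2 first.
  - exact: (measurableT_comp mv (measurable_fun_addn (mfX X) (mfX Y))).
  - by move=> t; exact: v0.
  congr expectation; apply/funext => t /=; rewrite sum_telescope2; congr (_ + _).
  (* The random ranges of summation are widened to [m], and the indicator of [I (a, b)] restores the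
     cut-offs. *)
  rewrite -(pair_bigA _ (fun a b => D (a, b) * \1_(I (a, b)) t))/=.
  rewrite (big_ord_widen _ (fun a => \sum_(b < f (Y t))
    (v (a + b).+2 - v (a + b).+1 *+ 2 + v (a + b)%N)) (fm (X t))).
  rewrite big_mkcond/=; apply: eq_bigr => a _.
  rewrite (big_ord_widen _ (fun b =>
    v (a + b).+2 - v (a + b).+1 *+ 2 + v (a + b)%N) (fm (Y t))).
  rewrite [X in if _ then X else _]big_mkcond/=; case: ifPn => aX.
    apply: eq_bigr => b _; case: ifPn => bY.
      by rewrite indicE mem_set ?mulr1.
    by rewrite indicE memNset ?mulr0// => -[_]/=; exact/negP.
  by rewrite big1// => b _; rewrite indicE memNset ?mulr0// => -[+ _]/=; exact/negP.
have mD p : measurable_fun [set: T] (fun t => D p * \1_(I p) t).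
  by apply: measurable_funM => //; exact: measurable_indic.
have D1 p t : 0 <= D p * \1_(I p) t by apply: mulr_ge0.
rewrite ge0_expectationD//; first last.
- by move=> t; apply: sumr_ge0.
- by move=> t; apply: addr_ge0.
- exact: measurable_sum.
- exact: (measurable_funD (mvX X) (mvX Y)).
rewrite ge0_expectationD//; last 2 first.
- exact: (mvX X).
- exact: (mvX Y).
congr (_ + _)%E; rewrite ge0_expectation_sum//; apply: eq_bigr => p _.
by rewrite ge0_expectationZl// ?expectation_indic.
Qed.

(** The marginal terms agree, and [antitone_measureI_le] minimises each orthant probability: level
    sets of a nondecreasing [f] are upper sets. *)
Lemma discrete_antitone_le (v : nat -> R) (f : R -> nat) (m : nat) X Y X' Y' :
  (forall k, 0 <= v k) ->
  (forall k, 0 <= v k.+2 - v k.+1 *+ 2 + v k) ->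
  {homo f : x y / x <= y >-> (x <= y)%N} -> (forall x, f x <= m)%N ->
  same_distribution P X X' -> same_distribution P Y Y' -> ae_antitone P X' Y' ->
  ('E_P[(fun t => v (f (X' t) + f (Y' t))%N)%R] <=
   'E_P[(fun t => v (f (X t) + f (Y t))%N)%R])%E.
Proof.
move=> v0 D0 fh fm XX YY [N [mN N0 anti]].
have mf := nondecreasing_nat_measurable fh.
have mvf : measurable_fun [set: R] (v \o f) by exact: measurableT_comp.
have mset (Z : {RV P >-> R}) a : measurable (Z @^-1` (f @^-1` [set k | (a < k)%N])).
  by rewrite -[X in measurable X]setTI; exact: (measurableT_comp mf).
rewrite -(@leeD2rE _ (v 0)%:E)// !(discrete_expectation_add _ _ v0 D0 mf fm).
rewrite (same_distribution_expectation XX mvf (fun x => v0 (f x))).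
rewrite (same_distribution_expectation YY mvf (fun x => v0 (f x))).
apply: leeD2l; apply: lee_sum => p _; apply: lee_wpmul2l; first by rewrite lee_fin.
have mset' a : measurable (f @^-1` [set k | (a < k)%N]).
  by rewrite -[X in measurable X]setTI; exact: mf.
apply: (@antitone_measureI_le N) => //; [by rewrite XX|by rewrite YY|].
move=> s t Ns Nt /= As Bs At; apply: leq_trans Bs _; apply/fh/anti => //.
rewrite ltNge; apply/negP => /fh h; apply: At; exact: leq_trans h.
Qed.

End two_variables.

(** * From grid values to clamped and then arbitrary real pairs *)

Definition clamp (R : realType) (K x : R) : R := Num.max (- K) (Num.min x K).

Section two_variables_limit.
Context {d : measure_display} {T : measurableType d} {R : realType}.
Context (P : probability T R).
Implicit Types (X Y : {RV P >-> R}) (w : R -> R).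

(* Hence [w (clamp K x + clamp K y) <= w 0 + w (x + y)] for convex [w >= 0]. *)
Lemma clamp_add_between (K x y : R) : 0 <= K ->
  Num.min 0 (x + y) <= clamp K x + clamp K y <= Num.max 0 (x + y).
Proof.
move=> K0; rewrite /clamp /Num.max /Num.min.
by do ?[case: ifPn]; rewrite -?leNgt; move=> *; apply/andP; split; lra.
Qed.

Lemma measurable_clamp (K : R) : measurable_fun [set: R] (clamp K).
Proof. by apply: measurable_maxr => //; exact: measurable_minr. Qed.

(** Cell number of [clamp K x] on the grid of mesh [1 / N.+1] starting at [-K]. The lower clamp is
    implicit, since [truncn] sends negative numbers to 0. *)
Definition grid_index (K : R) (N : nat) (x : R) : nat :=
  Num.truncn (N.+1%:R * (Num.min x K + K)).

Lemma grid_index_homo (K : R) (N : nat) :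
  {homo grid_index K N : x y / x <= y >-> (x <= y)%N}.
Proof.
move=> x y xy; apply/le_truncn/ler_wpM2l => //; rewrite lerD2r.
by rewrite le_min !ge_min xy lexx orbT.
Qed.

Lemma grid_index_le (K : R) (N : nat) (x : R) :
  (grid_index K N x <= Num.truncn (N.+1%:R * (K + K)))%N.
Proof. by apply/le_truncn/ler_wpM2l => //; rewrite lerD2r ge_min lexx orbT. Qed.

Lemma grid_index_clamp (K : R) (N : nat) (x : R) : 0 <= K ->
  0 <= clamp K x - ((grid_index K N x)%:R / N.+1%:R - K) <= N.+1%:R^-1.
Proof.
move=> K0; have N0 : 0 < N.+1%:R :> R by [].
have [h|h] := leP 0 (Num.min x K + K); last first.
  rewrite /grid_index (_ : Num.truncn _ = 0%N); last first.
    by apply/truncn0Pn; rewrite -ltNge (lt_trans _ ltr01)// pmulr_rlt0.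
  rewrite mul0r /clamp max_l; last lra.
  by rewrite sub0r opprK addNr lexx/= invr_ge0 ltW.
have /truncn_itv/andP[] : 0 <= N.+1%:R * (Num.min x K + K) by rewrite mulr_ge0// ltW.
rewrite -/(grid_index K N x) /clamp max_r; last lra.
rewrite -[(grid_index _ _ _).+1%:R]natr1; move: N.+1%:R N0 => M M0.
move: (grid_index _ _ _)%:R (Num.min _ _) => g z h1 h2.
have -> : z - (g / M - K) = (M * (z + K) - g) / M by field; rewrite gt_eqF.
rewrite divr_ge0 ?subr_ge0 ?(ltW M0)//= -[leRHS]mul1r ler_pM2r ?invr_gt0//; lra.
Qed.

Lemma clamp_antitone_le w (K : R) X Y X' Y' : 0 <= K ->
  convex_fun w -> (forall x, 0 <= w x) ->
  same_distribution P X X' -> same_distribution P Y Y' -> ae_antitone P X' Y' ->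
  ('E_P[(fun t => w (clamp K (X' t) + clamp K (Y' t)))%R] <=
   'E_P[(fun t => w (clamp K (X t) + clamp K (Y t)))%R])%E.
Proof.
move=> K0 cw w0 XX YY anti.
(* The sum of two indices carries the offset [K] twice. *)
pose v N k := w (k%:R / N.+1%:R - (K + K)).
pose h N (A B : {RV P >-> R}) t := v N (grid_index K N (A t) + grid_index K N (B t))%N.
have le_h N : ('E_P[h N X' Y'] <= 'E_P[h N X Y])%E.
  apply: (@discrete_antitone_le _ _ _ P (v N) (grid_index K N)
    (Num.truncn (N.+1%:R * (K + K))) X Y X' Y') => //.
  - by move=> k; exact: w0.
  - move=> k; rewrite /v; set M : R := N.+1%:R.
    (* With both increments equal to the mesh, superadditivity says that second differences are
       nonnegative. *)
    have := @convex_fun_superadd _ w (k%:R / M - (K + K)) M^-1 M^-1 cw (sqr_ge0 _).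
    have -> : k.+1%:R / M - (K + K) = k%:R / M - (K + K) + M^-1 :> R.
      by rewrite -natr1; ring.
    have -> : k.+2%:R / M - (K + K) = k%:R / M - (K + K) + M^-1 + M^-1 :> R.
      by rewrite -!natr1; ring.
    lra.
  - exact: grid_index_homo.
  - exact: grid_index_le.
have cvg_h (A B : {RV P >-> R}) :
    'E_P[h N A B]%E @[N --> \oo] --> 'E_P[(fun t => w (clamp K (A t) + clamp K (B t)))%R]%E.
  rewrite unlock.
  have mw := convex_fun_measurable cw.
  have mcl (Z : {RV P >-> R}) : measurable_fun [set: T] (fun t => clamp K (Z t)).
    exact: (measurableT_comp (measurable_clamp K)).
  have cvgR t : h N A B t @[N --> \oo] --> w (clamp K (A t) + clamp K (B t)).
    set L := clamp K (A t) + clamp K (B t).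
    pose g N := (grid_index K N (A t) + grid_index K N (B t))%N%:R / N.+1%:R - (K + K).
    suff gL : g N @[N --> \oo] --> L.
      exact: (@cvg_comp _ _ _ g w _ _ _ gL (@convex_fun_continuous _ w cw L)).
    apply: (@squeeze_cvgr _ _ _ _ (fun N => L - (harmonic N + harmonic N)) (fun=> L)).
    - apply: nearW => N; rewrite /L /g natrD mulrDl /harmonic/=.
      have /andP[] := grid_index_clamp N (A t) K0.
      have /andP[] := grid_index_clamp N (B t) K0.
      move: (grid_index K N (A t))%:R (grid_index K N (B t))%:R (N.+1%:R^-1) => i j M.
      by move=> *; apply/andP; split; lra.
    - rewrite -[X in _ --> X]subr0 -[X in _ --> L - X](addr0 (0 : R)).
      by apply: cvgB; [exact: cvg_cst|apply: cvgD; exact: cvg_harmonic].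
    - exact: cvg_cst.
  (* All arguments of [w] stay in [[-2K, 2K]], where a convex function is bounded by its end
     values. *)
  apply: (@dominated_cvg _ _ _ _ _ _ _ _
    (fun=> (Num.max (w (- (K + K))) (w (K + K)))%:E)) => //.
  - move=> N; apply/measurable_EFinP.
    have mg (Z : {RV P >-> R}) : measurable_fun [set: T] (fun t => grid_index K N (Z t)).
      exact: (measurableT_comp (nondecreasing_nat_measurable (@grid_index_homo K N))).
    have mv : measurable_fun [set: nat] (v N) by [].
    exact: (measurableT_comp mv (measurable_fun_addn (mg A) (mg B))).
  - move=> t _; apply: cvg_EFin; first exact: nearW.
    exact: cvgR.
  - exact: finite_measure_integrable_cst.
  - move=> N t _; rewrite lee_fin /h /v ger0_norm//.
    apply: convex_fun_le_max => //.
    have := grid_index_le K N (A t); have := grid_index_le K N (B t).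
    move: (grid_index K N (A t)) (grid_index K N (B t)) => i j ji ii.
    have M0 : 0 < N.+1%:R :> R by [].
    have mle : (Num.truncn (N.+1%:R * (K + K)))%:R <= N.+1%:R * (K + K).
      by rewrite truncn_le mulr_ge0//; lra.
    have ij : (i + j)%:R <= N.+1%:R * (K + K) + N.+1%:R * (K + K).
      by rewrite natrD lerD// (le_trans _ mle)// ler_nat.
    have : (i + j)%:R / N.+1%:R <= K + K + (K + K).
      by rewrite ler_pdivrMr// mulrC mulrDr.
    have : 0 <= (i + j)%:R / N.+1%:R :> R by [].
    move: ((i + j)%:R / N.+1%:R : R) => q.
      by move=> *; apply/andP; split; lra.
have cvg1 := cvg_h X' Y'.
have cvg2 := cvg_h X Y.
rewrite -(cvg_lim _ cvg1)// -(cvg_lim _ cvg2)//; apply: lee_lim.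
- by apply: cvgP cvg1.
- by apply: cvgP cvg2.
- by apply: nearW.
Qed.

(** Fatou's lemma, arranged for upper bounds [b k] that converge while the expectations of [f k]
    need not. *)
Lemma ge0_expectation_le_lim (f : nat -> T -> R) (g : T -> R)
    (b : nat -> \bar R) (l : \bar R) :
  (forall k, measurable_fun [set: T] (f k)) -> (forall k t, 0 <= f k t) ->
  (forall t, f k t @[k --> \oo] --> g t) ->
  (forall k, 'E_P[f k] <= b k)%E -> b k @[k --> \oo] --> l ->
  ('E_P[g] <= l)%E.
Proof.
move=> mf f0 fg fb bl.
have -> : 'E_P[g]%E = (\int[P]_t limn_einf (fun k => (f k t)%:E))%E.
  rewrite unlock; apply: eq_integral => t _.
  have /cvg_limn_einf_sup[-> //] : (f k t)%:E @[k --> \oo] --> (g t)%:E.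
  by apply: cvg_EFin; [exact: nearW|exact: fg].
have mf' k : measurable_fun [set: T] (fun t => (f k t)%:E) by exact/measurable_EFinP.
have f0' k t : [set: T] t -> (0 <= (f k t)%:E)%E by rewrite lee_fin.
have /le_trans := fatou P measurableT mf' f0'; apply.
rewrite limn_einf_lim -(cvg_lim _ bl)//; apply: lee_lim.
- exact: is_cvg_einfs.
- by apply: cvgP bl.
- apply: nearW => k; apply: le_trans (fb k); rewrite unlock.
  by apply: ereal_inf_lbound; exists k => /=.
Qed.

Lemma clamp_id (K x : R) : `|x| <= K -> clamp K x = x.
Proof. by rewrite ler_norml /clamp => /andP[? ?]; rewrite min_l// max_r. Qed.

Lemma clamp_near (x : R) : \forall k \near \oo, clamp k%:R x = x.
Proof.
by near=> k; apply: clamp_id; near: k; exact: nbhs_infty_ger.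
Unshelve. all: by end_near. Qed.

Lemma antitone_convex_le w X Y X' Y' :
  convex_fun w -> (forall x, 0 <= w x) ->
  same_distribution P X X' -> same_distribution P Y Y' -> ae_antitone P X' Y' ->
  ('E_P[(fun t => w (X' t + Y' t))%R] <= 'E_P[(fun t => w (X t + Y t))%R])%E.
Proof.
move=> cw w0 XX YY anti.
have mw := convex_fun_measurable cw.
(* A finite right-hand side makes [w 0 + w (X + Y)] an integrable dominator for the clamped sums. *)
have [->|] := eqVneq 'E_P[(fun t => w (X t + Y t))%R]%E +oo%E; first exact: leey.
rewrite -ltey => Eoo.
have mcl k (A B : {RV P >-> R}) :
    measurable_fun [set: T] (fun t => w (clamp k%:R (A t) + clamp k%:R (B t))).
  have mc (Z : {RV P >-> R}) :=
    measurableT_comp (measurable_clamp (k%:R : R)) (@measurable_funPT _ _ _ _ Z).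
  exact: (measurableT_comp mw (measurable_funD (mc A) (mc B))).
have cvgcl (A B : {RV P >-> R}) t :
    w (clamp k%:R (A t) + clamp k%:R (B t)) @[k --> \oo] --> w (A t + B t).
  apply: cvg_near_cst; near=> k; congr (w (_ + _)); near: k; exact: clamp_near.
have mXY : measurable_fun [set: T] (fun t => w (X t + Y t)).
  exact: (measurableT_comp mw (measurable_funD (@measurable_funPT _ _ _ _ X)
    (@measurable_funPT _ _ _ _ Y))).
apply: (@ge0_expectation_le_lim (fun k t => w (clamp k%:R (X' t) + clamp k%:R (Y' t))) _
  (fun k => 'E_P[(fun t => w (clamp k%:R (X t) + clamp k%:R (Y t)))%R]%E)) => //.
- by move=> k; apply: clamp_antitone_le.
rewrite unlock.
apply: (@dominated_cvg _ _ _ _ _ _ _ _ (fun t => (w 0 + w (X t + Y t))%:E)) => //.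
- by move=> k; apply/measurable_EFinP; exact: mcl.
- by move=> t _; apply: cvg_EFin; [exact: nearW|exact: cvgcl].
- apply/integrableP; split.
    by apply/measurable_EFinP; exact: measurable_funD.
  under eq_integral do rewrite gee0_abs ?lee_fin ?addr_ge0//.
  rewrite -[X in (X < _)%E](_ : 'E_P[(fun t => w 0 + w (X t + Y t))%R] = _)%E;
    last by rewrite unlock.
  have -> : ('E_P[(fun t => w 0 + w (X t + Y t))%R] =
      (w 0)%:E + 'E_P[(fun t => w (X t + Y t))%R])%E.
    by rewrite -(expectation_cst P) -ge0_expectationD// => t; exact: w0.
  by rewrite lte_add_pinfty ?ltry.
- move=> k t _; rewrite lee_fin ger0_norm//.
  have := clamp_add_between (X t) (Y t) (ler0n R k).
  move: (_ + clamp _ _) => z; rewrite /Num.max /Num.min; case: ifPn => h hz.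
    apply: le_trans (convex_fun_le_max cw hz) _.
    by rewrite ge_max lerDl lerDr !w0.
  apply: le_trans (convex_fun_le_max cw hz) _.
  by rewrite ge_max lerDl lerDr !w0.
Unshelve. all: by end_near. Qed.

End two_variables_limit.

(** * Combinatorics of pairwise antitone families of functions *)

Lemma pairwise_antitone_trichotomy (T : Type) (R : realType) (n : nat)
    (W : set T) (x : 'I_n -> T -> R) :
  (forall i j s t, i != j -> W s -> W t -> x i s < x i t -> x j t <= x j s) ->
  [\/ exists i j, forall k s t, k != i -> k != j -> W s -> W t -> x k s = x k t,
      exists M, (forall k s, W s -> x k s <= M k) /\
        (forall k l s, k != l -> W s -> x k s = M k \/ x l s = M l)
    | exists M, (forall k s, W s -> M k <= x k s) /\
        (forall k l s, k != l -> W s -> x k s = M k \/ x l s = M l)].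
Proof.
move=> anti.
have [?|nocst] := pselect (exists i j, forall k s t,
  k != i -> k != j -> W s -> W t -> x k s = x k t); first exact: Or31.
have {}nocst i j : exists k s t, [/\ k != i, k != j, W s, W t & x k s < x k t].
  apply: contrapT => h; apply: nocst; exists i, j => k s t ki kj Ws Wt.
  have [st|st|//] := ltgtP (x k s) (x k t); exfalso; apply: h.
    by exists k, s, t.
  by exists k, t, s.
(* Either some point is non-minimal in two coordinates at once, or none is; in the latter case the
   coordinatewise minima give the corner [M]. *)
have [[p [i [j [a [b [ij Wp Wa Wb []]]]]]]|nohigh] := pselect (exists p i j a b,
  [/\ i != j, W p, W a, W b & x i a < x i p /\ x j b < x j p]); last first.
  apply: Or33.
  have low i : exists q, W q /\ forall s, W s -> x i q <= x i s.
    have [k [s [t [ki _ Ws Wt st]]]] := nocst i i.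
    (* [t] minimises coordinate [i]: were [r] lower, [t] would exceed [r] in coordinate [i] and [s]
       in coordinate [k]. *)
    exists t; split => // r Wr; rewrite leNgt; apply/negP => rt.
    by apply: nohigh; exists t, k, i, s, r.
  have {low} [q qlow] := choice low.
  exists (fun i => x i (q i)); split => [k s Ws|k l s kl Ws].
    exact: (qlow k).2.
  have [Wk hk] := qlow k; have [Wl hl] := qlow l.
  have [->|hks] := eqVneq (x k s) (x k (q k)); [by left|right].
  apply/eqP; rewrite eq_le hl// andbT leNgt; apply/negP => lt.
  apply: nohigh; exists s, k, l, (q k), (q l).
  by split => //; split => //; rewrite lt_neqAle eq_sym hks hk.
(* [p] is above [a] in coordinate [i] and above [b] in coordinate [j]; the
   coordinatewise maximum of [a] and [b] is then the top corner [M]. *)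
move=> aip bjp; apply: Or32.
have ji : j != i by rewrite eq_sym.
have pja m : m != i -> x m p <= x m a by move=> mi; apply: (anti i) => //; rewrite eq_sym.
have pib m : m != j -> x m p <= x m b by move=> mj; apply: (anti j) => //; rewrite eq_sym.
have aib : x i a < x i b by apply: lt_le_trans aip (pib _ _).
have bja : x j b < x j a by apply: lt_le_trans bjp (pja _ _).
have ab m : m != i -> m != j -> x m b = x m a.
  move=> mi mj; apply/eqP; rewrite eq_le.
  by rewrite (anti i m a b)//=; [rewrite (anti j m b a)// eq_sym|rewrite eq_sym].
(* [a] and [b] agree off [i] and [j], and [a] is the higher one in [j], so only coordinate [i] comes
   from [b]. *)
pose M m := if m == i then x i b else x m a.
have Mi : M i = x i b by rewrite /M eqxx.
have Mne m : m != i -> M m = x m a by rewrite /M => /negbTE ->.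
(* A point above [a] in a third coordinate would lie strictly below [p] in both [i] and [j]. *)
have claim1 m r : m != i -> m != j -> W r -> x m r <= x m a.
  move=> mi mj Wr; rewrite leNgt; apply/negP => ar.
  have ri : x i r <= x i a by apply: (anti m).
  have rj : x j r <= x j b by apply: (anti m) => //; rewrite ab.
  have : x j p <= x j r by apply: (anti i) => //; exact: le_lt_trans aip.
  by move=> /(lt_le_trans bjp) /(le_lt_trans rj); rewrite ltxx.
(* Being low in a third coordinate [k] bounds all others from below; the resulting height in [i] and
   [j] bounds them from above. *)
have claim2 k r m : k != i -> k != j -> W r -> x k r < x k a -> m != k ->
    x m r = M m.
  move=> ki kj Wr rka mk.
  have bir : x i b <= x i r by apply: (anti k) => //; rewrite ab.
  have ajr : x j a <= x j r by apply: (anti k).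
  apply/eqP; rewrite eq_le /M; case: eqVneq => [->|mi].
    by rewrite bir andbT (anti j)//; exact: lt_le_trans ajr.
  rewrite (anti i m a r)//; [|by rewrite eq_sym|exact: lt_le_trans bir].
  by rewrite (anti k m r a)// eq_sym.
(* [r0] leaves the corner only in coordinate [k]. A point not below the corner in [k] is strictly
   above [r0] there, hence at most [M] in the other coordinates. *)
have [k [r0 [t [ki kj Wr0 Wt rt]]]] := nocst i j.
have r0a : x k r0 < x k a by apply: lt_le_trans rt (claim1 _ _ _ _ _).
have r0M m : m != k -> x m r0 = M m by apply: claim2.
exists M; split => [m s Ws|l m s lm Ws].
  have [mk|mk] := eqVneq m k; first by rewrite mk Mne// claim1.
  have [ska|ska] := ltP (x k s) (x k a); first by rewrite (claim2 k).
  by rewrite -r0M// (anti k)// 1?eq_sym//; exact: lt_le_trans ska.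
have out l' m' : l' != m' -> l' != i -> l' != j -> x l' s = M l' \/ x m' s = M m'.
  move=> lm' li lj; have [sla|] := ltP (x l' s) (x l' a).
    by right; apply: (claim2 l') => //; rewrite eq_sym.
  move=> als; left; rewrite Mne//; apply/eqP; rewrite eq_le als andbT.
  exact: claim1.
have in_ij : x i s = M i \/ x j s = M j.
  have [ska|ska] := ltP (x k s) (x k a); first by left; apply: (claim2 k) => //; rewrite eq_sym.
  have r0s : x k r0 < x k s by exact: lt_le_trans ska.
  have si : x i s <= x i r0 by apply: (anti k).
  have sj : x j s <= x j r0 by apply: (anti k).
  have [e|ne] := eqVneq (x i s) (x i r0); first by left; rewrite e r0M// eq_sym.
  right; rewrite -(r0M j) 1?eq_sym//; apply/eqP; rewrite eq_le sj/=.
  by apply: (anti i) => //; rewrite lt_neqAle ne.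
have [li|li] := eqVneq l i; last have [lj|lj] := eqVneq l j; last exact: out.
- have [mj|mj] := eqVneq m j; first by rewrite li mj.
  have [] := out m l => //; rewrite 1?eq_sym//; first by rewrite -li.
    by right.
  by left.
- have [mi|mi] := eqVneq m i; first by rewrite lj mi; have [] := in_ij; [right|left].
  have [] := out m l => //; rewrite 1?eq_sym//; first by rewrite -lj.
    by right.
  by left.
Qed.

(** * Convex comparison for counter-monotonic vectors *)

Section counter_monotonic.
Context {d : measure_display} {T : measurableType d} {R : realType}.
Context (P : probability T R).

(** Strict growth of [X] forces strict growth of the common factor [Z], along which [- Y] is
    nondecreasing. *)
Lemma counter_monotonic_antitone (X Y : T -> R) :
  counter_monotonic P X Y -> ae_antitone P X Y.
Proof.
move=> [Z [f [g [fh [gh [N [mN N0 XYN]]]]]]]; exists N; split => // s t Ns Nt.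
have inW r : ~ N r -> X r = f (Z r) /\ - Y r = g (Z r).
  by move=> Nr; apply: contrapT => h; apply/Nr/XYN.
have [-> Ys] := inW _ Ns; have [-> Yt] := inW _ Nt.
have [/fh|/ltW/gh] := leP (Z t) (Z s); first by move=> /le_lt_trans h /h; rewrite ltxx.
by rewrite -Ys -Yt lerN2.
Qed.

Lemma counter_monotonic_vec_antitone (n : nat) (X : 'I_n -> T -> R) :
  counter_monotonic_vec P X ->
  exists W, {ae P, forall t, W t} /\
    forall i j s t, i != j -> W s -> W t -> X i s < X i t -> X j t <= X j s.
Proof.
move=> cX.
have /choice[N hN] (p : 'I_n * 'I_n) : exists N, [/\ measurable N, P N = 0%E &
    p.1 != p.2 -> forall s t, ~ N s -> ~ N t -> X p.1 s < X p.1 t -> X p.2 t <= X p.2 s].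
  case: (eqVneq p.1 p.2) => [e|ne]; first by exists set0; split.
  by have [N [? ? ?]] := counter_monotonic_antitone (cX _ _ ne); exists N; split.
exists [set t | forall p, ~ N p t]; split.
  apply: filter_forall => p; have [mN N0 _] := hN p.
  by apply/negligibleP; rewrite setCK.
by move=> i j s t ij Ws Wt; have [_ _ /(_ ij)] := hN (i, j); apply.
Qed.

Context (n : nat) (X X' : 'I_n -> {RV P >-> R}).
Context (XX' : forall i, same_distribution P (X i) (X' i)).
Context (w : R -> R) (cw : convex_fun w) (w0 : forall x, 0 <= w x).

Let mw : measurable_fun [set: R] w := convex_fun_measurable cw.
Let mRV (Z : {RV P >-> R}) : measurable_fun [set: T] Z := @measurable_funPT _ _ _ _ Z.

Let mS (Z : 'I_n -> {RV P >-> R}) :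
  measurable_fun [set: T] (fun t => w (\sum_i Z i t)).
Proof. by apply: (measurableT_comp mw); apply: measurable_sum => i; exact: mRV. Qed.

(** With increments taken from [M], the marginal functional [G] satisfies [G X' = H X'] and
    [G X <= H X] almost surely, while [G X] and [G X'] have equal means. *)
Lemma mutually_exclusive_convex_le (M : 'I_n -> R) :
  (forall k, {ae P, forall t, M k <= X' k t}) \/
  (forall k, {ae P, forall t, X' k t <= M k}) ->
  {ae P, forall t, forall k l, k != l -> X' k t = M k \/ X' l t = M l} ->
  ('E_P[(fun t => w (\sum_i X' i t))%R] <= 'E_P[(fun t => w (\sum_i X i t))%R])%E.
Proof.
move=> sgn excl; pose a := \sum_i M i.
have shift (Z : 'I_n -> {RV P >-> R}) t : a + \sum_i (Z i t - M i) = \sum_i Z i t.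
  by rewrite sumrB addrC subrK.
pose g k x := w (a + (x - M k)).
have mg k : measurable_fun [set: R] (g k).
  apply: (measurableT_comp mw); apply: measurable_funD => //; exact: measurable_funB.
pose G (Z : 'I_n -> {RV P >-> R}) t := \sum_k g k (Z k t) + w a.
have mG Z : measurable_fun [set: T] (G Z).
  apply: measurable_funD => //; apply: measurable_sum => k.
  exact: (measurableT_comp (mg k) (mRV (Z k))).
have G0 Z t : 0 <= G Z t by rewrite addr_ge0// sumr_ge0// => k _; exact: w0.
have EG Z : 'E_P[G Z]%E = (\sum_k 'E_P[g k \o Z k] + (w a)%:E)%E.
  rewrite -(expectation_cst P (w a)) ge0_expectationD//.
  - congr (_ + _)%E; rewrite ge0_expectation_sum// => [k|k t]; last exact: w0.
    exact: (measurableT_comp (mg k) (mRV (Z k))).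
  - apply: measurable_sum => k; exact: (measurableT_comp (mg k) (mRV (Z k))).
  - by move=> t; apply: sumr_ge0 => k _; exact: w0.
have EGG : 'E_P[G X]%E = 'E_P[G X']%E.
  rewrite !EG; congr (_ + _)%E; apply: eq_bigr => k _.
  by apply: (same_distribution_expectation (XX' k)) => // x; exact: w0.
pose H (Z : 'I_n -> {RV P >-> R}) t := w (\sum_i Z i t) + n%:R * w a.
have nw0 : 0 <= n%:R * w a by apply: mulr_ge0.
have mH Z : measurable_fun [set: T] (H Z) by apply: measurable_funD => //; exact: mS.
have H0 Z t : 0 <= H Z t by rewrite addr_ge0.
have EH Z : 'E_P[H Z]%E = ('E_P[(fun t => w (\sum_i Z i t))%R] + (n%:R * w a)%:E)%E.
  rewrite -(expectation_cst P (n%:R * w a)) ge0_expectationD//; exact: mS.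
rewrite -(@leeD2rE _ (n%:R * w a)%:E)// -!EH.
have -> : 'E_P[H X']%E = 'E_P[G X']%E.
  apply: ge0_ae_eq_expectation => //; apply: filterS excl => t excl.
  rewrite /H /G -shift -(sum_disjoint_support w a)// => k l /excl[]->;
    rewrite subrr; by [left|right].
rewrite -EGG; apply: expectation_le => //.
(* One-sided bounds concern single marginals, so [X] inherits them from [X']. *)
have : {ae P, forall t, (forall k, 0 <= X k t - M k) \/ (forall k, X k t - M k <= 0)}.
  case: sgn => sgn.
    have /filter_forall : forall k, {ae P, forall t, M k <= X k t}.
      move=> k; apply: (@same_distribution_ae _ _ _ _ _ _ [set x | M k <= x] (XX' k));
        last exact: sgn.
      by rewrite -set_itvcy; exact: measurable_itv.
    by move=> h; apply: filterS h => t ht; left => k; rewrite subr_ge0.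
  have /filter_forall : forall k, {ae P, forall t, X k t <= M k}.
    move=> k; apply: (@same_distribution_ae _ _ _ _ _ _ [set x | x <= M k] (XX' k));
        last exact: sgn.
    by rewrite -set_itvNyc; exact: measurable_itv.
  by move=> h; apply: filterS h => t ht; right => k; rewrite subr_le0.
by move=> h; apply: filterS h => t /(convex_fun_sum_le a cw); rewrite shift.
Qed.

(** Being almost surely constant is a marginal property, so the same constants appear for [X] and
    are absorbed into a shift of [w]. Allowing [i = j] covers a single nonconstant component, where
    equal laws suffice. *)
Lemma two_nonconstant_convex_le (i j : 'I_n) (c : 'I_n -> R) :
  (i != j -> ae_antitone P (X' i) (X' j)) ->
  (forall k, k != i -> k != j -> {ae P, forall t, X' k t = c k}) ->
  ('E_P[(fun t => w (\sum_i X' i t))%R] <= 'E_P[(fun t => w (\sum_i X i t))%R])%E.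
Proof.
move=> anti cst'.
have cstX k : k != i -> k != j -> {ae P, forall t, X k t = c k}.
  by move=> ki kj; apply: (@same_distribution_ae _ _ _ _ _ _ [set c k] (XX' k)) => //; exact: cst'.
pose C := \sum_(k < n | (k != i) && (k != j)) c k.
pose S (Z : 'I_n -> {RV P >-> R}) t := if i == j then Z i t + C else Z i t + Z j t + C.
have mSS Z : measurable_fun [set: T] (fun t => w (S Z t)).
  apply: (measurableT_comp mw); rewrite /S; case: (i == j); apply: measurable_funD => //.
  exact: measurable_funD.
have ES (Z : 'I_n -> {RV P >-> R}) :
    (forall k, k != i -> k != j -> {ae P, forall t, Z k t = c k}) ->
    'E_P[(fun t => w (\sum_i Z i t))%R]%E = 'E_P[(fun t => w (S Z t))%R]%E.
  move=> hZ; apply: ge0_ae_eq_expectation => //.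
  have /filter_forall : forall k, {ae P, forall t, k != i -> k != j -> Z k t = c k}.
    move=> k; have [->|ki] := eqVneq k i; first by apply: nearW.
    have [->|kj] := eqVneq k j; first by apply: nearW.
    by apply: filterS (hZ _ ki kj).
  move=> h; apply: filterS h => t ht; congr w; rewrite /S.
  have -> : C = \sum_(k < n | (k != i) && (k != j)) Z k t.
    by apply: eq_bigr => k /andP[ki kj]; rewrite ht.
  rewrite (bigD1 i)//=; case: ifPn => [/eqP <-|ij].
    by congr (_ + _); apply: eq_bigl => k; rewrite andbb.
  by rewrite (bigD1 j) 1?eq_sym//= addrA.
rewrite (ES _ cst') (ES _ cstX) /S; case: (boolP (i == j)) => [_|ij].
  have cw' := convex_fun_shift C cw.
  by rewrite (same_distribution_expectation (XX' i) (convex_fun_measurable cw') (fun x => w0 _)).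
exact: (antitone_convex_le (convex_fun_shift C cw) _ (XX' i) (XX' j) (anti ij)).
Qed.

Lemma counter_monotonic_version_convex_le :
  counter_monotonic_vec P (fun i => (X' i : T -> R)) ->
  ('E_P[(fun t => w (\sum_i X' i t))%R] <= 'E_P[(fun t => w (\sum_i X i t))%R])%E.
Proof.
move=> cX; have [W [aeW anti]] := counter_monotonic_vec_antitone cX.
(* A set of full probability is nonempty; [t0] supplies the constant values in the first shape. *)
have [t0 Wt0] : exists t, W t.
  apply: contrapT => noW; case: aeW => N [mN N0 WN].
  have NT : N = setT by apply/seteqP; split => // t _; apply: WN => Wt; apply: noW; exists t.
  by move: N0; rewrite NT probability_setT => /eqP; rewrite onee_eq0.
have [[i [j hc]]|[M [lM eM]]|[M [lM eM]]] := pairwise_antitone_trichotomy anti.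
- apply: (@two_nonconstant_convex_le i j (fun k => X' k t0)) => [ij|k ki kj].
    exact: counter_monotonic_antitone (cX _ _ ij).
  by apply: filterS aeW => t Wt; exact: hc.
- apply: (@mutually_exclusive_convex_le M).
    by right => k; apply: filterS aeW => t; exact: lM.
  by apply: filterS aeW => t Wt k l kl; exact: eM.
- apply: (@mutually_exclusive_convex_le M).
    by left => k; apply: filterS aeW => t; exact: lM.
  by apply: filterS aeW => t Wt k l kl; exact: eM.
Qed.

End counter_monotonic.

(** * The convex order via the truncations [max (u + M) 0] *)

Theorem theorem6 (dm : measure_display) (T : measurableType dm) (R : realType)
  (P : probability T R) (n : nat) (X Xc : 'I_n -> {RV P >-> R}) :
  atomless P ->
  counter_monotonic_version X Xc ->
  cx_le P (fun w => \sum_(i < n) Xc i w) (fun w => \sum_(i < n) X i w).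
Proof.
move=> _ [cX XX] u cu _ wV.
have mu := convex_fun_measurable cu.
have mS (Z : 'I_n -> {RV P >-> R}) :
    measurable_fun [set: T] (u \o (fun t => \sum_i Z i t)).
  by apply: (measurableT_comp mu); apply: measurable_sum => i; exact: measurable_funPT.
apply: le_expectation_of_truncations => // M.
have cst0 : convex_fun (fun=> 0 : R) by move=> x y t _; rewrite !mulr0 addr0.
apply: (counter_monotonic_version_convex_le XX
  (convex_fun_max (convex_fun_addr M%:R cu) cst0)) => //.
by move=> x; rewrite le_max lexx orbT.
Qed.
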